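(* Let $r_1$ and $r_2$ be relations over the same attributes, $f$ an aggregate function and $MinSeuil>0$ a threshold such that the constraint ''$f(\cdot,r_2)\geq MinSeuil$'' on $CL(r_1\cup r_2)$ is antimonotone. Then the differential cube of $r_2$ with respect to $r_1$ is a convex cube, and $$CubeDifferentiel(r_2,r_1) = \{t\in CL(r_1\cup r_2)\mid f(t,r_2)\geq MinSeuil \text{ and } \nexists\, t'\in r_1 : t\preceq_g t'\}.$$
   Context: A relation $r$ is a finite nonempty collection of tuples over a finite nonempty set $\mathcal{D}$ of dimension attributes and a set of measure attributes. For $A\in\mathcal{D}$, $Dim(A)$ is the set of values of $A$ occurring in $r$; $\mathrm{ALL}$ is a new symbol not in any $Dim(A)$. The multidimensional space is $$Space(r) = \Big(\prod_{A\in\mathcal{D}} (Dim(A)\cup\{\mathrm{ALL}\})\Big)\cup\{(\emptyset,\dots,\emptyset)\},$$ where $(\emptyset,\dots,\emptyset)$ is an additional element. The generalization order on $Space(r)$ is: $u\preceq_g v$ iff either $v=(\emptyset,\dots,\emptyset)$, or $u,v\neq(\emptyset,\dots,\emptyset)$ and $u[A]=v[A]$ for all $A\in\mathcal{D}$ with $u[A]\neq\mathrm{ALL}$. The cube lattice is $CL(r)=\langle Space(r),\preceq_g\rangle$. Here $CL(r_1\cup r_2)$ is built from the dimension values occurring in $r_1$ or $r_2$, and tuples of $r_1$ and $r_2$, projected on $\mathcal{D}$, are regarded as elements of it. For $i=1,2$, $Datacube(r_i)$ is the set of $t\in CL(r_1\cup r_2)$ for which there is $t'\in r_i$ with $t\preceq_g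 t'$. For an aggregate function $f$ (on the measures, or counting tuples), $f(t,r_i)\in\mathbb{R}$ denotes the value of $f$ applied to the collection of tuples $t'$ of $r_i$ with $t\preceq_g t'$; by convention $f(t,r_i)=0$ if there is no such $t'$. The differential cube $CubeDifferentiel(r_2,r_1)$ is the set of tuples $t$ of $Datacube(r_2)$ with $f(t,r_2)\geq MinSeuil$ that do not belong to $Datacube(r_1)$ (set difference taken on dimension tuples). A constraint (predicate) $Const$ on $CL(r_1\cup r_2)$ is monotone if $t\preceq_g u$ and $Const(t)$ imply $Const(u)$, and antimonotone if $t\preceq_g u$ and $Const(u)$ imply $Const(t)$. A convex cube is a set of the form $\{t\in CL(r_1\cup r_2)\mid const(t)\}$, where $const$ is a conjunction of monotone and/or antimonotone constraints; such a set $\mathcal{C}$ is order-convex: $x\preceq_g y\preceq_g z$ and $x,z\in\mathcal{C}$ imply $y\in\mathcal{C}$. *)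

(* Defs.v *)
From HB Require Import structures.
From mathcomp Require Import all_boot all_order all_algebra.
From mathcomp Require Import finmap multiset.
From mathcomp Require Import boolp classical_sets reals.

Set Implicit Arguments.
Unset Strict Implicit.
Unset Printing Implicit Defensive.

Import Order.TTheory GRing.Theory Num.Theory.

Local Open Scope mset_scope.
Local Open Scope classical_set_scope.

(* Schema: dimension attributes D with domains V A, measure attributes M with
   domains W B.  A relation is a finite collection of tuples, possibly with
   repetitions, so that duplicates count in aggregates; relations viewed as
   sets are the multisets without repetitions. *)
Definition dtuple (D : finType) (V : D -> choiceType)
    (M : Type) (W : M -> choiceType) : choiceType :=
  ((forall A, V A) * (forall B, W B))%type.

Definition relation (D : finType) (V : D -> choiceType)
    (M : Type) (W : M -> choiceType) :=
  {mset (dtuple V W)}.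
Identity Coercion relation_multiset : relation >-> multiset_of.

(* [None : cell V] is the additional element (emptyset, ..., emptyset);
   in [Some u], [u A = None] means u[A] = ALL. *)
Definition cell (D : finType) (V : D -> choiceType) :=
  option (forall A, option (V A)).

Section GeneralizationOrder.
Variables (D : finType) (V : D -> choiceType).

HB.instance Definition _ := Choice.on (cell V).

Definition gen_le (u v : cell V) : bool :=
  match u, v with
  | _, None => true
  | None, Some _ => false
  | Some u, Some v => [forall A, (u A != None) ==> (u A == v A)]
  end.

Fact gen_le_refl : reflexive gen_le.
Proof. by case=> //= u; apply/forallP => A; rewrite eqxx implybT. Qed.

Fact gen_le_anti : antisymmetric gen_le.
Proof.
case=> [u|] [v|] //= /andP[/forallP uv /forallP vu].
congr Some; apply: functional_extensionality_dep => A.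
move: (uv A) (vu A); case: (u A) => [a|] /=; first by move=> /eqP ->.
by case: (v A) => [b|] //= _ /eqP.
Qed.

Fact gen_le_trans : transitive gen_le.
Proof.
case=> [v|] [u|] [w|] //= /forallP uv /forallP vw; apply/forallP => A.
apply/implyP => uA; have /eqP uvA := implyP (uv A) uA.
by rewrite uvA; apply: (implyP (vw A)); rewrite -uvA.
Qed.

Fact gen_display : Order.disp_t. Proof. exact: Order.Disp tt tt. Qed.

HB.instance Definition _ := Order.Le_isPOrder.Build gen_display (cell V)
  gen_le_refl gen_le_anti gen_le_trans.

End GeneralizationOrder.

Section CubeLattice.
Variables (D : finType) (V : D -> choiceType) (M : Type) (W : M -> choiceType).
Implicit Types (r s : relation V W) (t u : cell V) (c C : set (cell V)).

Definition cell_of (x : dtuple V W) : cell V := Some (fun A => Some (x.1 A)).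

Definition Dim r (A : D) : set (V A) :=
  [set a | exists2 x, x \in r & x.1 A = a].
Arguments Dim r A : clear implicits.

Definition MDSpace r : set (cell V) :=
  [set t | if t is Some u
           then forall A, if u A is Some a then Dim r A a else True
           else True].

Definition monotone r c :=
  forall t u, MDSpace r t -> MDSpace r u -> (t <= u)%O -> c t -> c u.

Definition antimonotone r c :=
  forall t u, MDSpace r t -> MDSpace r u -> (t <= u)%O -> c u -> c t.

Definition convex_cube r C :=
  exists (n : nat) (c : 'I_n -> set (cell V)),
    (forall i, monotone r (c i) \/ antimonotone r (c i)) /\
    C = [set t | MDSpace r t /\ forall i, c i t].

(* datacube of s inside the cube lattice of r; used with r the union of
   the two relations that are compared *)
Definition Datacube r s : set (cell V) :=
  [set t | MDSpace r t /\ exists2 x, x \in s & (t <= cell_of x)%O].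

Definition covered s t : {mset (dtuple V W)} :=
  seq_mset [seq x <- s | (t <= cell_of x)%O].

Definition agg (R : realType) (f : {mset (dtuple V W)} -> R) t (s : relation V W) : R :=
  if covered s t == mset0 then 0%R else f (covered s t).

Definition CubeDifferentiel (R : realType) (f : {mset (dtuple V W)} -> R)
    (MinSeuil : R) r2 r1 : set (cell V) :=
  let r := (r1 `|` r2)%mset in
  [set t | Datacube r r2 t /\ (MinSeuil <= agg f t r2)%R] `\` Datacube r r1.

End CubeLattice.

(* Main.v *)
Require Import Defs.
From mathcomp Require Import all_boot all_order all_algebra.
From mathcomp Require Import finmap multiset.
From mathcomp Require Import boolp classical_sets reals.

Local Open Scope classical_set_scope.

(** By convention the aggregate is 0 on a cell that covers no tuple, so a value of at least
    [MinSeuil > 0] already places the cell below some tuple of [r2], that is, in the datacube of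
    [r2] ([agg_gt0_covered]). Inside the space, leaving the datacube of [r1] means covering no tuple
    of [r1]. The cube is thus cut out by an antimonotone threshold and a monotone non-covering
    condition ([not_covered_monotone]), hence convex. *)

Section AggregateSupport.
Variables (R : realType) (D : finType) (V : D -> choiceType).
Variables (M : Type) (W : M -> choiceType).

Lemma agg_gt0_covered (f : {mset (dtuple V W)}%mset -> R) (t : cell V)
    (s : relation V W) :
  (0 < agg f t s)%R -> exists2 x, x \in s & (t <= cell_of x)%O.
Proof.
rewrite /agg; case: ifPn => [_|]; first by rewrite Order.POrderTheory.ltxx.
case: (mset_0Vmem (covered s t)) => [->|[x]]; first by rewrite eqxx.
(* Nonzero multiplicity in [covered s t] is membership in the filtered sequence, which gives the
   witness. *)
rewrite -mset_neq0 mset_seqE -lt0n -has_count has_pred1 mem_filter.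
by case/andP=> tx xs _ _; exists x.
Qed.

(** By transitivity the cells below some tuple form a down-set; its complement is an up-set. *)
Lemma not_covered_monotone (r s : relation V W) :
  monotone r [set t | ~ exists2 x, x \in s & (t <= cell_of x)%O].
Proof.
move=> t u _ _ tu nt [x xs ux]; apply: nt; exists x => //.
exact: Order.POrderTheory.le_trans ux.
Qed.

End AggregateSupport.

Theorem proposition4p4 (R : realType)
    (D : finType) (V : D -> choiceType) (M : Type) (W : M -> choiceType)
    (r1 r2 : relation V W) (f : {mset (dtuple V W)}%mset -> R) (MinSeuil : R)
    (D_nonempty : (0 < #|D|)%N)
    (r1_nonempty : r1 != mset0) (r2_nonempty : r2 != mset0)
    (MinSeuil_gt0 : (0 < MinSeuil)%R)
    (f_antimonotone : antimonotone (r1 `|` r2)%mset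
       [set t | (MinSeuil <= agg f t r2)%R]) :
  convex_cube (r1 `|` r2)%mset (CubeDifferentiel f MinSeuil r2 r1) /\
  CubeDifferentiel f MinSeuil r2 r1 =
    [set t | MDSpace (r1 `|` r2)%mset t /\ (MinSeuil <= agg f t r2)%R /\
             ~ exists2 t', t' \in r1 & (t <= cell_of t')%O].
Proof.
have cubeE : CubeDifferentiel f MinSeuil r2 r1 =
    [set t | MDSpace (r1 `|` r2)%mset t /\ (MinSeuil <= agg f t r2)%R /\
             ~ exists2 t', t' \in r1 & (t <= cell_of t')%O].
  apply/seteqP; split=> t /= => [[[[tr _] ft] nt]|[tr [ft nt]]].
    by split=> //; split=> // t1; apply: nt.
  split; last by case.
  (* The tuple of [r2] above [t] comes from [0 < MinSeuil <= agg f t r2]. *)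
  do 2!split=> //; apply: (@agg_gt0_covered _ _ _ _ _ f).
  exact: Order.POrderTheory.lt_le_trans ft.
split=> //; rewrite cubeE.
(* Index 0 carries the antimonotone threshold, index 1 the monotone condition on [r1]. *)
exists 2, (fun i : 'I_2 => if i == ord0
  then [set t | (MinSeuil <= agg f t r2)%R]
  else [set t | ~ exists2 t', t' \in r1 & (t <= cell_of t')%O]).
split=> [i|].
  by case: (i == ord0); [right | left; apply: not_covered_monotone].
apply/seteqP; split=> t /= => [[tr [ft nt]]|[tr ct]].
  by split=> // i; case: (i == ord0).
by split=> //; split; [exact: ct ord0 | exact: ct ord_max].
Qed.
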